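(* Let $p$ be a prime, let $x\in\mathbb{C}_p$, and let $n=mp^r\in\mathbb{N}$ with $m\in\mathbb{N}$, $p\nmid m$ and $r\in\mathbb{N}_0$. Let $x_0,\dots,x_\omega$ be the finite sequence in $\mathbb{C}_p$ attached to $x$ and $r$ (defined in the context). Then $$\sum_{k=0}^{n-1}\operatorname{Log}\Gamma_p\bigg(\frac{x+k}{n}\bigg)=\sum_{j=0}^{\omega}\operatorname{Log}\Gamma_p(x_j)-\log_p(n)\sum_{j=0}^{\omega}\mathrm{R}_p(x_j).$$
   Context: $\mathbb{N}=\{1,2,3,\dots\}$, $\mathbb{N}_0=\mathbb{N}\cup\{0\}$. $\mathbb{C}_p$ is the completion of the algebraic closure of $\mathbb{Q}_p$, with absolute value $|\cdot|_p$; $\mathcal{Z}_p=\{x\in\mathbb{C}_p: |x|_p\le 1\}$ is its ring of integers. For $x\in\mathcal{Z}_p$, $\overline{x}$ denotes its image in the residue field of $\mathbb{C}_p$ (isomorphic to $\overline{\mathbb{F}}_p$), which contains $\mathbb{F}_p$. If $x\in\mathcal{Z}_p$ and $\overline{x}\in\mathbb{F}_p$, then $\ell(x)$ is the unique natural number with $1\le\ell(x)\le p$ and $\overline{x}=\overline{\ell(x)}$. $\log_p:\mathbb{C}_p^*\to\mathbb{C}_p$ is the Iwasawa $p$-adic logarithm: the homomorphism given by the usual power series of the logarithm on $\{|x-1|_p<1\}$ and normalized by $\log_p(p)=0$. The Volkenborn integral of $g:\mathbb{Z}_p\to\mathbb{C}_p$ is $\int_{\mathbb{Z}_p}g(t)\,dt:=\lim_{N\to\infty}p^{-N}\sum_{j=0}^{p^N-1}g(j)$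 when the limit exists. Let $\chi:\mathbb{C}_p\to\{0,1\}$ be the characteristic function of $\{x\in\mathbb{C}_p:|x|_p\ge1\}$. The function $\operatorname{Log}\Gamma_p:\mathbb{C}_p\to\mathbb{C}_p$ is defined by $$\operatorname{Log}\Gamma_p(x):=\int_{\mathbb{Z}_p}(x+t)\big(\log_p(x+t)-1\big)\chi(x+t)\,dt,$$ the integrand being $0$ whenever $|x+t|_p<1$. The function $\mathrm{R}_p:\mathbb{C}_p\to\mathbb{C}_p$ is defined by $\mathrm{R}_p(x):=x-\frac{x}{p}+\frac{\alpha}{p}-\left\lceil\frac{\alpha}{p}\right\rceil$ if $|x-\alpha|_p<1$ for some $\alpha\in\mathbb{Z}$ (the value does not depend on the choice of $\alpha$; $\lceil c\rceil$ is the usual integer ceiling of $c\in\mathbb{Q}$), and $\mathrm{R}_p(x):=x-\frac12$ otherwise. The sequence: put $x_0:=x$. Given $x_j$, if $x_j\notin\mathcal{Z}_p$, or $x_j\in\mathcal{Z}_p$ but $\overline{x_j}\notin\mathbb{F}_p$, the process stops at $x_j$; if $x_j\in\mathcal{Z}_p$ and $\overline{x_j}\in\mathbb{F}_p$, put $x_{j+1}:=\frac{x_j+p-\ell(x_j)}{p}$. Let $s$ be the least non-negative integer such that $x_s\notin\mathcal{Z}_p$, or $x_s\in\mathcal{Z}_p$ but $\overline{x_s}\notin\mathbb{F}_p$ (and $s=+\infty$ if there is none), and set $\omega=\min(r,s)$. The sequence is $x_0,\dots,x_\omega$. *)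

(* Defs.v *)
From HB Require Import structures.
From mathcomp Require Import all_boot all_order all_algebra.
From mathcomp Require Import mathcomp_extra boolp classical_sets functions.
From mathcomp Require Import reals topology normedtype sequences numfun.

Set Implicit Arguments.
Unset Strict Implicit.
Unset Printing Implicit Defensive.

Import Order.TTheory GRing.Theory Num.Theory.
Import numFieldNormedType.Exports.

Local Open Scope classical_set_scope.
Local Open Scope ring_scope.

(* The norm classes of MathComp require `|x *+ n| = `|x| *+ n, which fails for *)
(* p-adic absolute values, so absolute values are plain functions K -> R here, *)
(* and convergence in K is convergence of the distances to 0 in R.             *)

Section AbsoluteValues.
Variable R : realType.

Record nonarch_absval (K : fieldType) (v : K -> R) : Prop := NonarchAbsval {
  absval_ge0 : forall x, 0 <= v x;
  absval_eq0 : forall x, v x = 0 <-> x = 0;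
  absvalM : forall x y, v (x * y) = v x * v y;
  absvalD : forall x y, v (x + y) <= Num.max (v x) (v y)
}.

Definition converges (K : fieldType) (v : K -> R) (u : nat -> K) (l : K) : Prop :=
  (fun n => v (u n - l)) @ \oo --> (0 : R).

Definition cauchy_sequence (K : fieldType) (v : K -> R) (u : nat -> K) : Prop :=
  forall e : R, 0 < e ->
    exists N : nat, forall m n : nat, (N <= m)%N -> (N <= n)%N ->
      v (u m - u n) < e.

Record is_completion (F K : fieldType) (vF : F -> R) (vK : K -> R)
    (f : {rmorphism F -> K}) : Prop := IsCompletion {
  completion_isometry : forall a, vK (f a) = vF a;
  completion_dense : forall (y : K) (e : R), 0 < e -> exists a, vK (y - f a) < e;
  completion_complete : forall u : nat -> K,
    cauchy_sequence vK u -> exists l, converges vK u l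
}.

Record is_algebraic_closure (F L : fieldType) (f : {rmorphism F -> L}) : Prop :=
  IsAlgebraicClosure {
    closure_algebraic : forall y : L, algebraicOver f y;
    closure_closed : GRing.closed_field_axiom L
  }.

Definition padic_abs (p : nat) (q : rat) : R :=
  if q == 0 then 0
  else p%:R ^ ((logn p `|denq q|)%:Z - (logn p `|numq q|)%:Z).

(* C_p is determined up to isometric isomorphism as the completion of an       *)
(* algebraic closure of Q_p, Q_p being the completion of Q; a term of this type *)
(* is any such tower, and it coerces to its top field.                         *)
Structure padicComplex (p : nat) := PadicComplex {
  Qp : fieldType;
  Qp_abs : Qp -> R;
  Qp_absval : nonarch_absval Qp_abs;
  Qp_of_rat : {rmorphism rat -> Qp};
  Qp_completion : is_completion (padic_abs p) Qp_abs Qp_of_rat;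
  Qpbar : fieldType;
  Qpbar_abs : Qpbar -> R;
  Qpbar_absval : nonarch_absval Qpbar_abs;
  Qpbar_of_Qp : {rmorphism Qp -> Qpbar};
  Qpbar_isometry : forall a, Qpbar_abs (Qpbar_of_Qp a) = Qp_abs a;
  Qpbar_closure : is_algebraic_closure Qpbar_of_Qp;
  Cp :> fieldType;
  Cp_abs : Cp -> R;
  Cp_absval : nonarch_absval Cp_abs;
  Cp_of_Qpbar : {rmorphism Qpbar -> Cp};
  Cp_completion : is_completion Qpbar_abs Cp_abs Cp_of_Qpbar
}.

End AbsoluteValues.

Section LogGamma.
Variables (R : realType) (p : nat) (C : padicComplex R p).
Implicit Types (x y : C).

Local Notation abs := (@Cp_abs R p C).

(* 0 when the sequence diverges *)
Definition plim (u : nat -> C) : C := xget 0 [set l | converges abs u l].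

(* The value at 0 is left unconstrained. *)
Record iwasawa_log (L : C -> C) : Prop := IwasawaLog {
  iwasawa_logM : forall x y, x != 0 -> y != 0 -> L (x * y) = L x + L y;
  iwasawa_log_series : forall x, abs (x - 1) < 1 ->
    converges abs
      (fun n => \sum_(1 <= k < n.+1) (-1) ^+ k.-1 * (x - 1) ^+ k / k%:R) (L x);
  iwasawa_log_p : L p%:R = 0
}.

(* Only the values of g on the naturals, hence on Z_p, are used. *)
Definition volkenborn (g : C -> C) : C :=
  plim (fun N => (p ^ N)%:R^-1 * \sum_(j < p ^ N) g j%:R).

Definition chi : C -> C := \1_[set x | 1 <= abs x].

Definition LogGamma (logp : C -> C) (x : C) : C :=
  volkenborn (fun t => (x + t) * (logp (x + t) - 1) * chi (x + t)).

Definition Rp (x : C) : C :=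
  if pselect (exists a : int, abs (x - a%:~R) < 1) is left _ then
    let a := xget 0 [set a : int | abs (x - a%:~R) < 1] in
    x - x / p%:R + a%:~R / p%:R - (Num.ceil (a%:Q / p%:Q))%:~R
  else x - 2^-1.

Definition integral x : Prop := abs x <= 1.

(* equality of the images in the residue field: the difference lies in the     *)
(* maximal ideal of the valuation ring                                         *)
Definition same_residue x y : Prop := abs (x - y) < 1.

(* F_p is the image of Z in the residue field *)
Definition residue_in_Fp x : Prop := exists a : int, same_residue x a%:~R.

Definition ell x : nat :=
  xget 0%N [set l : nat | (1 <= l <= p)%N /\ same_residue x l%:R].

(* x_j; meaningful for j up to the stopping index only *)
Definition xseq x (j : nat) : C :=
  iter j (fun y => (y + p%:R - (ell y)%:R) / p%:R) x.

Definition stops_at x (j : nat) : bool :=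
  `[< ~ integral (xseq x j) \/
      (integral (xseq x j) /\ ~ residue_in_Fp (xseq x j)) >].

(* None encodes s = +oo *)
Definition stop_index x : option nat :=
  if pselect (exists j, stops_at x j) is left H then Some (ex_minn H) else None.

Definition omega x (r : nat) : nat :=
  if stop_index x is Some s then minn r s else r.

End LogGamma.

(* Main.v *)
(* Write [f_c y = y (log y - 1 - c)] for |y| >= 1 and 0 otherwise, with         *)
(* [c = log n]. Collecting the sums over k and over the Volkenborn partial sums *)
(* turns the left-hand side into the Volkenborn integral of                     *)
(* [y (log y - 1 - c) 1_(|y| >= p^-r)] at [y = x + t], up to averaging over     *)
(* [m p^N] instead of [p^N] points; this does not change the limit because      *)
(* [f_c] is differentiable with a uniform quadratic remainder. The points with  *)
(* |x + t| < 1 are exactly the [p (x_1 + t')], where [log p = 0], so the part   *)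
(* of the integral over them is the same integral at [x_1] with [r - 1] in      *)
(* place of [r]. Iterating leaves the sum over j of the integrals of [f_c] at   *)
(* [x_j + t], each equal to [LogGamma x_j - c Rp x_j].                          *)

Require Import Defs.
From mathcomp Require Import all_boot all_order all_algebra.
From mathcomp Require Import reals.
From mathcomp Require Import boolp classical_sets topology normedtype.
From mathcomp Require Import sequences numfun.
From mathcomp Require Import ring zify.
Import Order.TTheory GRing.Theory Num.Theory.
Import numFieldNormedType.Exports.
Local Open Scope ring_scope.

(** Everything is phrased through [mean a h x N], the sum of [h] over the [a * p ^ N] points x, x +
    1, ..., divided by p^N; for a = 1 these are the Volkenborn partial sums at x. As k runs below n
    and i below p^N, the points (x + k)/n + i are the (x + l)/n with l < m p^(N+r), each hit once.
    Since log(y/n) = log y - log n and |n| = p^-r, the left-hand side is therefore 1/m times a limit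
    of means with a = m of y (log y - 1 - log n) cut off at |y| >= p^-r ([sum_mean_div]). Two facts
    evaluate this limit. First, a function with a uniform quadratic Taylor remainder has convergent
    means, and a factor a in the length just multiplies the limit by a ([mean_converges],
    [mean_mul_converges]); the integrand on |y| >= 1 is such a function
    ([log_integrand_differentiable]). Second, what lives on |y| < 1 occupies one point in every p,
    namely the points p (x_1 + i), so its mean at x is a rescaled mean at x_1 ([mean_residue]); as
    log p = 0, the rescaled integrand is the same one with r lowered by 1
    ([truncated_integrand_mul_prime]). Induction on r gives [truncated_integrand_converges]. Each
    term carries R_p because R_p(x) is the Volkenborn integral of (x + t) chi(x + t)
    ([mul_chi_converges]). Uniqueness of limits concludes. *)

Lemma sum_ord_mul (V : zmodType) (F : nat -> V) (a b : nat) :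
  \sum_(i < a * b) F i = \sum_(i < a) \sum_(j < b) F (i * b + j)%N.
Proof.
rewrite -(big_mkord xpredT) big_nat_mul big_mkord; apply: eq_bigr => i _.
by rewrite -{1}[(i * b)%N]add0n mulSn big_addn addnK big_mkord;
  apply: eq_bigr => j _; rewrite addnC.
Qed.

Lemma natr_mulE_sum (V : pzRingType) (n : nat) (a : V) :
  n%:R * a = \sum_(i < n) a.
Proof. by rewrite mulr_natl sumr_const card_ord. Qed.

(** * Limits for a nonarchimedean absolute value *)

Section NonarchimedeanConvergence.
Context {R : realType} {K : fieldType} {v : K -> R} (nv : nonarch_absval v).

Lemma absval_0 : v 0 = 0.
Proof. exact/(absval_eq0 nv). Qed.

Lemma absval_1 : v 1 = 1.
Proof.
have v1 : v 1 != 0 by apply/eqP => /(absval_eq0 nv)/eqP; rewrite oner_eq0.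
by apply: (mulfI v1); rewrite -(absvalM nv) !mulr1.
Qed.

Lemma absval_gt0 (x : K) : x != 0 -> 0 < v x.
Proof.
move=> x0; rewrite lt_def (absval_ge0 nv) andbT.
by apply: contra x0 => /eqP/(absval_eq0 nv) ->.
Qed.

Lemma absvalN (x : K) : v (- x) = v x.
Proof.
suff vN1 : v (-1) = 1 by rewrite -mulN1r (absvalM nv) vN1 mul1r.
have := absval_1; rewrite -[in v 1](mulr1 1) -[1 * 1]mulrNN (absvalM nv) -expr2.
by move/eqP; rewrite sqrp_eq1 ?(absval_ge0 nv) // => /eqP.
Qed.

Lemma absvalV (x : K) : v x^-1 = (v x)^-1.
Proof.
have [->|x0] := eqVneq x 0; first by rewrite invr0 absval_0 invr0.
apply: (mulfI (lt0r_neq0 (absval_gt0 x x0))).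
by rewrite -(absvalM nv) !divff ?absval_1 // lt0r_neq0 // absval_gt0.
Qed.

Lemma absvalX (x : K) (n : nat) : v (x ^+ n) = v x ^+ n.
Proof.
by elim: n => [|n IHn]; rewrite ?absval_1 // !exprS (absvalM nv) IHn.
Qed.

Lemma absvalD_le (x y : K) (b : R) : v x <= b -> v y <= b -> v (x + y) <= b.
Proof.
by move=> xb yb; apply: le_trans (absvalD nv x y) _; rewrite ge_max xb.
Qed.

Lemma absvalD_lt (x y : K) (b : R) : v x < b -> v y < b -> v (x + y) < b.
Proof.
by move=> xb yb; apply: le_lt_trans (absvalD nv x y) _; rewrite gt_max xb.
Qed.

Lemma absvalB_lt (x y : K) (b : R) : v x < b -> v y < b -> v (x - y) < b.
Proof. by move=> xb yb; apply: absvalD_lt; rewrite ?absvalN. Qed.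

Lemma absval_sum_le (n : nat) (F : 'I_n -> K) (b : R) : 0 <= b ->
  (forall i, v (F i) <= b) -> v (\sum_(i < n) F i) <= b.
Proof.
move=> b0 Fb; elim/big_ind : _ => //; first by rewrite absval_0.
by move=> x y xb yb; apply: absvalD_le.
Qed.

Lemma absvalD_eq (x y : K) : v y < v x -> v (x + y) = v x.
Proof.
move=> yx; apply: le_anti; rewrite absvalD_le //; last exact: ltW.
rewrite leNgt; apply/negP => xyx.
by have := absvalB_lt _ _ _ xyx yx; rewrite addrK ltxx.
Qed.

Lemma absval_nat_le1 (n : nat) : v n%:R <= 1.
Proof.
elim: n => [|n IHn]; first by rewrite absval_0.
by rewrite -natr1 absvalD_le // absval_1.
Qed.

Lemma absval_int_le1 (a : int) : v a%:~R <= 1.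
Proof.
case: a => n; first exact: absval_nat_le1.
by rewrite NegzE mulrNz absvalN; exact: absval_nat_le1.
Qed.

Lemma convergesP (u : nat -> K) (l : K) : converges v u l <->
  (forall e : R, 0 < e -> exists N, forall n, (N <= n)%N -> v (u n - l) < e).
Proof.
split=> [/cvgrPdist_lt ul e e0|ul].
  have [N _ HN] := ul e e0; exists N => n Nn; have := HN n Nn.
  by rewrite /= sub0r normrN ger0_norm // (absval_ge0 nv).
apply/cvgrPdist_lt => e e0; have [N HN] := ul e e0.
exists N => // n /= Nn.
by rewrite sub0r normrN ger0_norm ?(absval_ge0 nv) //; apply: HN.
Qed.

Lemma converges_unique (u : nat -> K) (l l' : K) :
  converges v u l -> converges v u l' -> l = l'.
Proof.
move=> /convergesP ul /convergesP ul'; apply/eqP/negPn/negP => ll'.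
have e0 : 0 < v (l - l') by rewrite absval_gt0 // subr_eq0.
have [N HN] := ul _ e0; have [N' HN'] := ul' _ e0.
have := absvalB_lt _ _ _ (HN' _ (leq_maxr N N')) (HN _ (leq_maxl N N')).
have -> x : x - l' - (x - l) = l - l' by ring.
by rewrite ltxx.
Qed.

Lemma converges_cst (l : K) : converges v (fun=> l) l.
Proof.
by apply/convergesP => e e0; exists 0%N => n _; rewrite subrr absval_0.
Qed.

Lemma convergesD (u u' : nat -> K) (l l' : K) :
  converges v u l -> converges v u' l' ->
  converges v (fun n => u n + u' n) (l + l').
Proof.
move=> /convergesP ul /convergesP ul'; apply/convergesP => e e0.
have [N HN] := ul _ e0; have [N' HN'] := ul' _ e0.
exists (maxn N N') => n; rewrite geq_max => /andP[Nn N'n].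
by rewrite opprD addrACA absvalD_lt ?HN ?HN'.
Qed.

Lemma convergesMl (c : K) (u : nat -> K) (l : K) :
  converges v u l -> converges v (fun n => c * u n) (c * l).
Proof.
have [->|c0 /convergesP ul] := eqVneq c 0.
  move=> _; rewrite mul0r (_ : (fun n => 0 * u n) = fun=> 0).
    exact: converges_cst.
  by apply: funext => n; rewrite mul0r.
apply/convergesP => e e0.
have [N HN] := ul _ (divr_gt0 e0 (absval_gt0 c c0)).
exists N => n Nn.
rewrite -mulrBr (absvalM nv) mulrC -ltr_pdivlMr ?absval_gt0 //.
exact: HN.
Qed.

Lemma converges_sum (n : nat) (u : 'I_n -> nat -> K) (l : 'I_n -> K) :
  (forall i, converges v (u i) (l i)) ->
  converges v (fun N => \sum_(i < n) u i N) (\sum_(i < n) l i).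
Proof.
elim: n u l => [|n IHn] u l ul.
  rewrite big_ord0 (_ : (fun _ => _) = fun=> 0); first exact: converges_cst.
  by apply: funext => N; rewrite big_ord0.
rewrite big_ord_recl (_ : (fun _ => _) =
  fun N => u ord0 N + \sum_(i < n) u (lift ord0 i) N).
  by apply: convergesD => //; apply: IHn => i.
by apply: funext => N; rewrite big_ord_recl.
Qed.

Lemma converges_shift (k : nat) (u : nat -> K) (l : K) :
  converges v (fun n => u (n + k)%N) l <-> converges v u l.
Proof.
rewrite !convergesP; split=> ul e e0; have [N HN] := ul e e0.
  exists (N + k)%N => n Nn.
  have kn : (k <= n)%N by rewrite (leq_trans _ Nn) // leq_addl.
  by rewrite -(subnK kn); apply: HN; rewrite leq_subRL // addnC.
by exists N => n Nn; apply: HN; rewrite (leq_trans Nn) // leq_addr.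
Qed.

Lemma converges_absB_le (u : nat -> K) (l a : K) (b : R) : converges v u l ->
  (forall n, v (u n - a) <= b) -> v (l - a) <= b.
Proof.
move=> /convergesP ul ub; rewrite leNgt; apply/negP => bl.
have b0 : 0 < v (l - a).
  exact: le_lt_trans (le_trans (absval_ge0 nv _) (ub 0%N)) bl.
have [N HN] := ul _ b0.
have := absvalB_lt _ _ _ (le_lt_trans (ub N) bl) (HN N (leqnn N)).
have -> : u N - a - (u N - l) = l - a by ring.
by rewrite ltxx.
Qed.

Lemma geometric_lt (q b e : R) : 0 <= q < 1 -> 0 < e ->
  exists N, forall n, (N <= n)%N -> b * q ^+ n < e.
Proof.
move=> /andP[q0 q1] e0.
have /cvgrPdist_lt/(_ e e0)[N _ HN] :
    (geometric b q x @[x --> \oo] --> (0 : R))%classic.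
  by apply: cvg_geometric; rewrite ger0_norm.
exists N => n /HN /=; rewrite sub0r normrN; exact: le_lt_trans (ler_norm _).
Qed.

Lemma converges_geometric (u : nat -> K) (l : K) (q b : R) : 0 <= q < 1 ->
  (forall n, v (u n - l) <= b * q ^+ n) -> converges v u l.
Proof.
move=> q01 ub; apply/convergesP => e e0.
have [N HN] := geometric_lt q b e q01 e0.
by exists N => n /HN; exact: le_lt_trans.
Qed.

Lemma cauchy_geometric (u : nat -> K) (q b : R) : 0 <= q < 1 -> 0 <= b ->
  (forall n, v (u n.+1 - u n) <= b * q ^+ n) -> cauchy_sequence v u.
Proof.
move=> q01 b0 ub e e0; have [N HN] := geometric_lt q b e q01 e0.
have [q0 /ltW q1] := andP q01.
have uN k : v (u (N + k)%N - u N) < e.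
  elim: k => [|k IHk]; first by rewrite addn0 subrr absval_0.
  rewrite addnS -(subrK (u (N + k)%N) (u _.+1)) -addrA absvalD_lt //.
  by apply: le_lt_trans (ub _) _; apply: HN; rewrite leq_addr.
exists N => m n /subnKC <- /subnKC <-.
by have := absvalB_lt _ _ _ (uN (m - N)%N) (uN (n - N)%N);
  rewrite opprB addrA subrK.
Qed.

End NonarchimedeanConvergence.

(** * The p-adic absolute value of integers in C_p *)

Section PadicComplex.
Context {R : realType} {p : nat} (p_prime : prime p) {C : padicComplex R p}.
Implicit Types (x y d : C) (h g : C -> C).

Local Notation abs := (@Cp_abs R p C).
Local Notation nv := (@Cp_absval R p C).
Local Notation q := (p%:R^-1 : R).

Lemma abs_nat (n : nat) : (0 < n)%N -> abs n%:R = q ^+ logn p n.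
Proof.
move=> n0; have -> : n%:R = Cp_of_Qpbar C (Qpbar_of_Qp C (Qp_of_rat C n%:R)).
  by rewrite !rmorph_nat.
rewrite (completion_isometry (Cp_completion C)) Qpbar_isometry.
rewrite (completion_isometry (Qp_completion C)) /padic_abs pnatr_eq0 gtn_eqF //.
have -> : n%:R = n%:Z%:Q :> rat by rewrite -pmulrn.
rewrite numq_int denq_int /= logn1 sub0r; case: (logn p n) => [|k].
  by rewrite oppr0 expr0z expr0.
by rewrite exprVn -exprnN.
Qed.

Lemma q_gt0 : 0 < q.
Proof. by rewrite invr_gt0 ltr0n prime_gt0. Qed.

Lemma q_itv : 0 <= q < 1.
Proof.
by rewrite ltW ?q_gt0 //= invf_lt1 ?ltr0n ?prime_gt0 // ltr1n prime_gt1.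
Qed.

Lemma abs_expn_prime (N : nat) : abs (p ^ N)%:R = q ^+ N.
Proof. by rewrite abs_nat ?expn_gt0 ?prime_gt0 // pfactorK. Qed.

Lemma abs_prime : abs p%:R = q.
Proof. by rewrite abs_nat ?prime_gt0 // -[X in logn _ X]expn1 pfactorK. Qed.

Lemma natr_neq0 (n : nat) : (0 < n)%N -> (n%:R : C) != 0.
Proof.
move=> n0; apply/eqP => /(absval_eq0 nv); rewrite abs_nat // => /eqP.
by rewrite expf_eq0 gt_eqF ?q_gt0 // andbF.
Qed.

(** The valuation v of n satisfies v < p^v <= n. This crude bound is enough for the logarithm series
    on |d| <= 1/p, for every p including 2. *)
Lemma abs_natV_le (n : nat) : (0 < n)%N -> (abs n%:R)^-1 <= p%:R ^+ n.-1.
Proof.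
move=> n0; rewrite abs_nat // exprVn invrK -!natrX ler_nat.
rewrite leq_pexp2l ?prime_gt0 //.
rewrite -ltnS prednK // (leq_trans (ltn_expl _ (prime_gt1 p_prime))) //.
by rewrite dvdn_leq // pfactor_dvdnn.
Qed.

(** * Convergence of means of differentiable functions *)

Definition mean (a : nat) (h : C -> C) (x : C) (N : nat) : C :=
  (p ^ N)%:R^-1 * \sum_(i < a * p ^ N) h (x + i%:R).

(** Here [g] is the derivative of [h]. The bound [B] is uniform in the base point, and the
    increments have size at most 1/p, which covers all shifts by multiples of p. *)
Definition quadratically_differentiable (h g : C -> C) : Prop :=
  exists2 B : R, 0 <= B & forall y d, abs d <= q ->
    abs (h (y + d) - h y - d * g y) <= B * abs d ^+ 2 /\
    abs (g (y + d) - g y) <= B * abs d.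

(* The sums [G N] below satisfy [G N.+1 = p G N + O(p ^- N)]. *)
Lemma sum_derivative_le (h g : C -> C) x : quadratically_differentiable h g ->
  exists2 L : R, 0 <= L & forall N,
    abs (\sum_(i < p ^ N.+1) g (x + i%:R)) <= L * q ^+ N.+1.
Proof.
case=> B B0 hg; have [/andP[q0 q1] qgt0] := (q_itv, q_gt0).
set G := fun N => \sum_(i < p ^ N) g (x + i%:R).
(* The first entry starts the induction, the second absorbs the error B p^-(N+1) at level N+2. The
   start is G 1 because a shift by i p^N is known to have size at most 1/p only once N >= 1. *)
exists (Num.max (abs (G 1%N) / q) (B / q)).
  by rewrite le_max !divr_ge0 ?(absval_ge0 nv).
elim=> [|N IHN].
  rewrite expr1 maxr_pMl // divfK ?gt_eqF // le_max lexx //.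
rewrite -/(G N.+2) -(subrK (p%:R * G N.+1) (G N.+2)).
rewrite (absvalD_le nv) //.
  rewrite /G expnS (sum_ord_mul _ (fun i => g (x + i%:R))) natr_mulE_sum.
  rewrite -sumrB; apply: absval_sum_le; [exact: nv|..].
    by rewrite mulr_ge0 ?exprn_ge0 // le_max !divr_ge0 ?(absval_ge0 nv).
  move=> i; rewrite -sumrB; apply: absval_sum_le; [exact: nv|..].
    by rewrite mulr_ge0 ?exprn_ge0 // le_max !divr_ge0 ?(absval_ge0 nv).
  move=> j; rewrite natrD [_ %:R + _]addrC addrA.
  have ip : abs (i * p ^ N.+1)%:R <= q ^+ N.+1.
    rewrite natrM (absvalM nv) abs_expn_prime.
    by rewrite ler_piMl ?exprn_ge0 // absval_nat_le1 //; exact: nv.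
  apply: le_trans (proj2 (hg _ _ _)) _.
    by apply: le_trans ip _; rewrite exprS ler_piMr // exprn_ile1 ?ltW.
  apply: (@le_trans _ _ (B / q * q ^+ N.+2)).
    by rewrite exprS mulrA divfK ?gt_eqF // ler_wpM2l.
  by rewrite ler_wpM2r ?exprn_ge0 // le_max lexx orbT.
rewrite (absvalM nv) abs_prime.
by rewrite exprS mulrCA ler_wpM2l // ltW.
Qed.

(** With e the shift, the second-order remainders are O(|e|^2) termwise, and the first-order parts
    add up to e times a sum of derivatives, itself O(p^-(N+1)) by [sum_derivative_le]. Hence the
    square. *)
Lemma sum_increment_le (h g : C -> C) x : quadratically_differentiable h g ->
  exists2 L : R, 0 <= L & forall a N,
    abs (\sum_(i < p ^ N.+1) (h (x + (a * p ^ N.+1 + i)%:R) - h (x + i%:R)))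
      <= L * q ^+ N.+1 ^+ 2.
Proof.
move=> hg; have [L L0 GL] := sum_derivative_le h g x hg.
case: hg => B B0 hg; have [/andP[q0 q1] qgt0] := (q_itv, q_gt0).
exists (Num.max B L) => [|a N]; first by rewrite le_max B0.
have aN : abs (a * p ^ N.+1)%:R <= q ^+ N.+1.
  rewrite natrM (absvalM nv) abs_expn_prime.
  by rewrite ler_piMl ?exprn_ge0 // absval_nat_le1 //; exact: nv.
set e := (a * p ^ N.+1)%:R in aN.
rewrite (_ : \sum_(_ < _) _ =
  \sum_(i < p ^ N.+1) (h (x + i%:R + e) - h (x + i%:R) - e * g (x + i%:R))
  + e * \sum_(i < p ^ N.+1) g (x + i%:R)); last first.
  rewrite mulr_sumr -big_split /=; apply: eq_bigr => i _.
  by rewrite subrK natrD [_%:R + _]addrC addrA.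
apply: absvalD_le; first exact: nv.
  apply: absval_sum_le => [||i]; first exact: nv.
    by rewrite mulr_ge0 ?exprn_ge0 // le_max B0.
  apply: le_trans (proj1 (hg _ _ _)) _.
    by apply: le_trans aN _; rewrite exprS ler_piMr // exprn_ile1 ?ltW.
  rewrite ler_pM ?exprn_ge0 ?(absval_ge0 nv) ?le_max ?lexx //.
  by rewrite lerXn2r // nnegrE ?exprn_ge0 ?(absval_ge0 nv).
rewrite (absvalM nv) [_ ^+ 2]expr2 mulrCA ler_pM ?(absval_ge0 nv) //.
apply: le_trans (GL N) _; rewrite ler_wpM2r ?exprn_ge0 // le_max lexx orbT //.
Qed.

(** The long sum consists of a shifted copies of the short one; dividing the quadratic error of each
    copy by p^(N+1) costs only one of its two factors. *)
Lemma mean_mul_le (h g : C -> C) x : quadratically_differentiable h g ->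
  exists2 L : R, 0 <= L & forall a N,
    abs (mean a h x N.+1 - a%:R * mean 1 h x N.+1) <= L * q ^+ N.+1.
Proof.
move=> hg; have [L L0 DL] := sum_increment_le h g x hg.
have [/andP[q0 q1] qgt0] := (q_itv, q_gt0).
exists L => // a N.
rewrite /mean mul1n mulrCA -mulrBr (absvalM nv) (absvalV nv).
rewrite abs_expn_prime (sum_ord_mul _ (fun i => h (x + i%:R))) natr_mulE_sum.
rewrite -sumrB mulrC ler_pdivrMr ?exprn_gt0 // -mulrA -expr2.
apply: absval_sum_le => [||i]; first exact: nv.
  by rewrite mulr_ge0 ?exprn_ge0.
by rewrite -sumrB; exact: DL.
Qed.

(** The mean with a = 1 at one level is 1/p times the mean with a = p at the level below, so
    [mean_mul_le] for a = p bounds consecutive differences geometrically. *)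
Lemma mean_converges (h g : C -> C) x : quadratically_differentiable h g ->
  exists l, converges abs (mean 1 h x) l.
Proof.
move=> hg; have [L L0 ML] := mean_mul_le h g x hg.
have [/andP[q0 q1] qgt0] := (q_itv, q_gt0).
suff [l hl] : exists l, converges abs (fun N => mean 1 h x (N + 1)%N) l.
  by exists l; move/(converges_shift nv): hl.
apply: (completion_complete (Cp_completion C)).
apply: (cauchy_geometric nv _ q L q_itv L0) => N.
have pN0 : (p%:R : C) != 0 by rewrite natr_neq0 ?prime_gt0.
have -> : mean 1 h x (N.+1 + 1) - mean 1 h x (N + 1)
    = p%:R^-1 * (mean p h x N.+1 - p%:R * mean 1 h x N.+1).
  rewrite !addn1 mulrBr mulKf // /mean mul1n -expnS.
  by rewrite mulrA -invfM -natrM -expnS.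
rewrite (absvalM nv) (absvalV nv) abs_prime.
by rewrite mulrC ler_pdivrMr // -mulrA -exprSr.
Qed.

Lemma mean_mul_converges (h g : C -> C) x a l :
  quadratically_differentiable h g ->
  converges abs (mean 1 h x) l -> converges abs (mean a h x) (a%:R * l).
Proof.
move=> hg hl; have [L L0 ML] := mean_mul_le h g x hg.
have -> : mean a h x = fun N =>
    (mean a h x N - a%:R * mean 1 h x N) + a%:R * mean 1 h x N.
  by apply: funext => N; rewrite subrK.
rewrite -[a%:R * l]add0r; apply: (convergesD nv).
  2: exact: convergesMl nv _ _ _ hl.
apply/(converges_shift nv 1).
apply: (converges_geometric nv _ _ q (L * q) q_itv) => N.
by rewrite addn1 subr0 -mulrA -exprS.
Qed.

(** * The cutoff chi and the logarithmic integrand *)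

Lemma chiE x : chi x = if 1 <= abs x then 1 else 0 :> C.
Proof.
rewrite /chi indicE; have [x1|x1] := boolP (1 <= abs x).
  by rewrite mem_set.
by rewrite memNset //; apply/negP.
Qed.

Lemma absD_ge1 y d : abs d < 1 -> (1 <= abs (y + d)) = (1 <= abs y).
Proof.
move=> d1; have [y1|y1] := leP 1 (abs y).
  by rewrite (absvalD_eq nv) // (lt_le_trans d1).
by rewrite leNgt (absvalD_lt nv).
Qed.

Lemma chiD y d : abs d < 1 -> chi (y + d) = chi y :> C.
Proof. by move=> d1; rewrite !chiE absD_ge1. Qed.

Section Logarithm.
Context {logp : C -> C} (logpI : iwasawa_log logp).

(** Once d is removed, the series has terms d^(i+2)/(i+2) up to sign; |d|^i <= p^-i and |1/(i+2)| <=
    p^(i+1) leave p |d|^2, and the ultrametric inequality passes this to the sum. *)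
Lemma log1p_quadratic d : abs d <= q ->
  abs (logp (1 + d) - d) <= p%:R * abs d ^+ 2.
Proof.
move=> dq; have [/andP[q0 q1] qgt0] := (q_itv, q_gt0).
have d1 : abs (1 + d - 1) < 1 by rewrite addrC addKr (le_lt_trans dq).
have := @iwasawa_log_series _ _ _ _ logpI _ d1.
rewrite -(converges_shift nv 1) => logd.
apply: (converges_absB_le nv _ _ _ _ logd) => n.
rewrite addn1 big_ltn // expr0 expr1 divr1 mul1r.
rewrite [1 + d]addrC addrK addrAC subrr add0r.
rewrite -[2%N]/(0 + 2)%N big_addn subn2 /= big_mkord.
apply: absval_sum_le; first exact: nv.
  by rewrite mulr_ge0 // exprn_ge0 // (absval_ge0 nv).
move=> i; rewrite !(absvalM nv) !(absvalX nv) (absvalN nv) (absval_1 nv).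
rewrite expr1n mul1r (absvalV nv) exprD mulrAC.
rewrite ler_wpM2r ?exprn_ge0 ?(absval_ge0 nv) //.
apply: (@le_trans _ _ (q ^+ i * p%:R ^+ (i + 2).-1)).
  rewrite ler_pM ?exprn_ge0 ?invr_ge0 ?(absval_ge0 nv) ?abs_natV_le ?addn2 //.
  by rewrite lerXn2r // nnegrE (absval_ge0 nv).
rewrite addn2 /= exprS mulrCA -exprMn mulVf ?expr1n ?mulr1 //.
by rewrite pnatr_eq0 -lt0n prime_gt0.
Qed.

Lemma log1p_le d : abs d <= q -> abs (logp (1 + d)) <= abs d.
Proof.
move=> dq; rewrite -(subrK d (logp _)) (absvalD_le nv) //.
apply: le_trans (log1p_quadratic d dq) _; rewrite expr2 mulrA.
rewrite ler_piMl ?(absval_ge0 nv) //.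
by rewrite mulrC -ler_pdivlMr ?mul1r // ltr0n prime_gt0.
Qed.

(** On |y| < 1 everything vanishes near y, since chi is constant on open unit discs. On |y| >= 1 the
    increment of log is log(1 + d/y) with |d/y| <= |d|, which makes the bounds uniform in y. *)
Lemma log_integrand_differentiable (c : C) :
  quadratically_differentiable (fun y => y * (logp y - 1 - c) * chi y)
    (fun y => (logp y - c) * chi y).
Proof.
exists p%:R => // y d dq; have [/andP[q0 q1] qgt0] := (q_itv, q_gt0).
rewrite !chiD ?(le_lt_trans dq) // chiE.
have [y1|_] := leP 1 (abs y); last first.
  rewrite !mulr0 !subrr (absval_0 nv) ?mulr_ge0 ?exprn_ge0 ?(absval_ge0 nv) //.

rewrite !mulr1; have y0 : y != 0.
  by apply: contraTneq y1 => ->; rewrite (absval_0 nv) -ltNge.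
have u_le : abs (d / y) <= abs d.
  rewrite (absvalM nv) (absvalV nv) ler_piMr ?(absval_ge0 nv) //.
  by rewrite invf_le1 // (lt_le_trans _ y1).
have uq := le_trans u_le dq.
have yd0 : 1 + d / y != 0.
  apply/eqP => /(absval_eq0 nv); rewrite (absvalD_eq nv) (absval_1 nv).
    by move/eqP; rewrite oner_eq0.
  exact: le_lt_trans uq _.
have -> : logp (y + d) = logp y + logp (1 + d / y).
  by rewrite -(iwasawa_logM logpI) // mulrDr mulr1 mulrCA divff // mulr1.
split; last first.
  rewrite (_ : _ - _ = logp (1 + d / y)); last by ring.
  apply: le_trans (log1p_le _ uq) _; apply: le_trans u_le _.
  by rewrite ler_peMl ?(absval_ge0 nv) // ler1n prime_gt0.
have -> : (y + d) * (logp y + logp (1 + d / y) - 1 - c) - y * (logp y - 1 - c)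
    - d * (logp y - c) = y * (logp (1 + d / y) - d / y) + d * logp (1 + d / y).
  by field.
apply: (absvalD_le nv); rewrite (absvalM nv).
  apply: le_trans (ler_wpM2l (absval_ge0 nv _) (log1p_quadratic _ uq)) _.
  rewrite mulrCA ler_wpM2l // (absvalM nv) (absvalV nv) exprMn mulrCA.
  rewrite ler_piMr ?exprn_ge0 ?(absval_ge0 nv) // expr2 mulrA divff; last first.
    by rewrite gt_eqF // (lt_le_trans _ y1).
  by rewrite mul1r invf_le1 // (lt_le_trans _ y1).
apply: (@le_trans _ _ (abs d ^+ 2)).
  by rewrite expr2 ler_wpM2l ?(absval_ge0 nv) // (le_trans (log1p_le _ uq)).
by rewrite ler_peMl ?exprn_ge0 ?(absval_ge0 nv) // ler1n prime_gt0.
Qed.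

End Logarithm.

(** * Residues modulo p and the passage from x to x_1 *)

Lemma dvdz_abs_lt1 (a : int) : abs a%:~R < 1 -> (p %| a)%Z.
Proof.
rewrite dvdzE /= (_ : abs _ = abs `|a|%N%:R); last first.
  by case: a => n //; rewrite NegzE mulrNz (absvalN nv) abszN.
case: `|a|%N => [|n]; first by rewrite dvdn0.
rewrite abs_nat // => n1; apply/negPn/negP => pn.
by move: n1; rewrite lognE (negPf pn) !andbF expr0 ltxx.
Qed.

Lemma ell_spec x : residue_in_Fp x ->
  (1 <= ell x <= p)%N /\ abs (x - (ell x)%:R) < 1.
Proof.
case=> a xa; suff H : exists l, (1 <= l <= p)%N /\ same_residue x l%:R.
  exact: (xgetPex 0%N H).
have p0 : (p%:Z != 0) by rewrite -lt0n prime_gt0.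
(* Reducing a - 1 instead of a puts the representative k + 1 in 1..p rather than 0..p-1. *)
have [k Ek] : exists k : nat, ((a - 1) %% p)%Z = k.
  by exists `|((a - 1) %% p)%Z|%N; rewrite gez0_abs // modz_ge0.
have kp : (k < p)%N by rewrite -ltz_nat -Ek ltz_pmod // ltz_nat prime_gt0.
exists k.+1; split; first by [].
rewrite /same_residue -(subrK a%:~R x) -addrA (absvalD_lt nv) //.
rewrite (_ : a%:~R - k.+1%:R = ((a - 1) %/ p)%Z%:~R * p%:R).
  rewrite (absvalM nv) abs_prime; apply: (@le_lt_trans _ _ q).
    by rewrite ler_piMl ?(absval_int_le1 nv) // ltW ?q_gt0.
  by case/andP: q_itv.
rewrite [p%:R]pmulrn -intrM [k.+1%:R]pmulrn -intrB; congr (_%:~R).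
apply/eqP; rewrite subr_eq -addn1 PoszD addrA -subr_eq -Ek; apply/eqP.
exact: divz_eq.
Qed.

(** The integer [ell x + k] is a multiple of p strictly between 0 and 2p. *)
Lemma ell_unique x (k : nat) : residue_in_Fp x -> (k < p)%N ->
  abs (x + k%:R) < 1 -> k = (p - ell x)%N.
Proof.
move=> xFp kp xk; have [/andP[l1 lp] xl] := ell_spec x xFp.
have : abs (ell x + k)%N%:~R < 1.
  rewrite -pmulrn natrD (_ : _ + _ = x + k%:R - (x - (ell x)%:R)); last by ring.
  exact: (absvalB_lt nv).
move/dvdz_abs_lt1; rewrite dvdzE /= => /dvdnP[[|[|t]]].
- by move/eqP; rewrite mul0n addn_eq0 => /andP[/eqP l0]; rewrite l0 in l1.
- by rewrite mul1n => E; rewrite -[k](addKn (ell x)) E.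
move=> E; exfalso; have := leq_add lp kp.
by rewrite addnS E !mulSn; lia.
Qed.

(** The map iterated in [xseq], named so that inductions can peel off its first application. *)
Definition step (y : C) : C := (y + p%:R - (ell y)%:R) / p%:R.

Lemma mul_stepE x (i : nat) : residue_in_Fp x ->
  p%:R * (step x + i%:R) = x + (i * p + (p - ell x))%N%:R.
Proof.
move=> /ell_spec[/andP[_ lp] _]; have p0 := natr_neq0 p (prime_gt0 p_prime).
by rewrite natrD natrM natrB // /step; field.
Qed.

Lemma abs_mul_step_lt1 x (i : nat) : residue_in_Fp x ->
  abs (p%:R * (step x + i%:R)) < 1.
Proof.
move=> xFp; have [/andP[_ lp] xl] := ell_spec x xFp.
rewrite mul_stepE // natrD natrM natrB //.
rewrite (_ : _ + _ = x - (ell x)%:R + i.+1%:R * p%:R).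
  2: by rewrite -natr1; ring.
rewrite (absvalD_lt nv) // (absvalM nv) abs_prime; apply: (@le_lt_trans _ _ q).
  by rewrite ler_piMl ?(absval_nat_le1 nv) // ltW ?q_gt0.
by case/andP: q_itv.
Qed.

Lemma abs_ge1_of_no_residue x (i : nat) :
  ~ residue_in_Fp x -> 1 <= abs (x + i%:R).
Proof.
move=> xFp; rewrite leNgt; apply/negP => xi; apply: xFp; exists (- i%:Z).
by rewrite /same_residue mulrNz opprK.
Qed.

Lemma meanD a h g x N :
  mean a (fun y => h y + g y) x N = mean a h x N + mean a g x N.
Proof. by rewrite /mean big_split mulrDr. Qed.

Lemma meanZ a (c : C) h x N : mean a (fun y => c * h y) x N = c * mean a h x N.
Proof. by rewrite /mean -mulr_sumr mulrCA. Qed.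

Lemma eq_mean a h g x N : (forall i : nat, h (x + i%:R) = g (x + i%:R)) ->
  mean a h x N = mean a g x N.
Proof. by move=> hg; congr (_ * _); apply: eq_bigr => i _. Qed.

Lemma mean_no_residue a h x N : (forall y, 1 <= abs y -> h y = 0) ->
  ~ residue_in_Fp x -> mean a h x N = 0.
Proof.
move=> h0 xFp; rewrite /mean big1 ?mulr0 // => i _.
by rewrite h0 ?abs_ge1_of_no_residue.
Qed.

(** Among p consecutive points x + i p + k, only k = p - [ell x] lies in the open unit disc, and
    that point is p ([step x] + i). One factor 1/p of the mean is left over and goes into the
    function. *)
Lemma mean_residue a h x N : (forall y, 1 <= abs y -> h y = 0) ->
  residue_in_Fp x ->
  mean a h x N.+1 = mean a (fun z => p%:R^-1 * h (p%:R * z)) (step x) N.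
Proof.
move=> h0 xFp; rewrite meanZ /mean expnSr mulnA.
rewrite (sum_ord_mul _ (fun i => h (x + i%:R))).
rewrite natrM invfM [_^-1 * _^-1]mulrC -mulrA; congr (_ * (_ * _)).
have [/andP[l1 lp] xl] := ell_spec x xFp.
have k0p : (p - ell x < p)%N by rewrite ltn_subrL l1 prime_gt0.
apply: eq_bigr => i _.
rewrite (bigD1 (Ordinal k0p)) //= big1 ?addr0 ?mul_stepE // => k kk0.
apply: h0; rewrite leNgt; apply: contra kk0 => xk.
apply/eqP/val_inj/(ell_unique x) => //=.
rewrite (_ : _ + _ = x + (i * p + k)%:R - i%:R * p%:R); last first.
  by rewrite natrD natrM; ring.
rewrite (absvalB_lt nv) // (absvalM nv) abs_prime; apply: (@le_lt_trans _ _ q).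
  by rewrite ler_piMl ?(absval_nat_le1 nv) // ltW ?q_gt0.
by case/andP: q_itv.
Qed.

(** * R_p as a Volkenborn integral *)

Lemma mean_id_converges x : converges abs (mean 1 id x) (x - 2^-1).
Proof.
have two0 : (2%:R : C) != 0 by exact: natr_neq0.
apply: (converges_geometric nv _ _ q ((abs 2%:R)^-1) q_itv) => N.
have sumE n : \sum_(i < n) (x + i%:R) = n%:R * (x + (n%:R - 1) / 2%:R).
  elim: n => [|n IHn]; first by rewrite big_ord0 mul0r.
  by rewrite big_ord_recr /= IHn -natr1; field.
have pN0 : (p ^ N)%:R != 0 :> C by rewrite natr_neq0 ?expn_gt0 ?prime_gt0.
rewrite /mean mul1n sumE mulKf //.
rewrite (_ : _ - _ = 2%:R^-1 * (p ^ N)%:R); last by field.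
by rewrite (absvalM nv) (absvalV nv) abs_expn_prime.
Qed.

Lemma Rp_residue x : residue_in_Fp x -> Rp x = x - step x.
Proof.
move=> xFp; rewrite /Rp; case: pselect => // Hx.
have := xgetPex (0 : int) Hx; set a := xget _ _ => /= xa.
have [/andP[l1 lp] xl] := ell_spec x xFp.
have : abs (a - (ell x)%:Z)%:~R < 1.
  rewrite intrB -pmulrn.
  rewrite (_ : _ - _ = (x - (ell x)%:R) - (x - a%:~R)); last by ring.
  exact: (absvalB_lt nv).
move/dvdz_abs_lt1/dvdzP => [k /(canRL (subrK _)) ->].
have p0 := natr_neq0 p (prime_gt0 p_prime).
have pQ : 0 < p%:Q by rewrite ltr0z ltz_nat prime_gt0.
(* Since 1 <= [ell x] <= p, the quotient [ell x] / p lies in (0, 1]; this is why [ell] ranges over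
   1..p. *)
have -> : Num.ceil ((k * p%:Z + (ell x)%:Z)%:~R / p%:Q) = k + 1.
  apply: ceil_def; rewrite addrK ltr_pdivlMr // ler_pdivrMr // -!intrM.
  by rewrite ltr_int ler_int; lia.
rewrite /step intrD intrM intrD -!pmulrn; field.
exact: p0.
Qed.

Lemma Rp_no_residue x : ~ residue_in_Fp x -> Rp x = x - 2^-1.
Proof. by rewrite /Rp; case: pselect. Qed.

Lemma mul_chi_converges x :
  converges abs (mean 1 (fun y => y * chi y) x) (Rp x).
Proof.
(* Then y chi(y) = y + e(y). As e(p z)/p = -z on the disc, [mean_residue] turns the mean of e at x
   into minus that of the identity at [step x]: the two halves cancel and x - [step x] remains. *)
pose e y := if 1 <= abs y then 0 else - y.
have e0 y : 1 <= abs y -> e y = 0 by rewrite /e => ->.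
have -> : mean 1 (fun y => y * chi y) x = fun N => mean 1 id x N + mean 1 e x N.
  apply: funext => N; rewrite -meanD; apply: eq_mean => i.
  by rewrite chiE /e; case: ifP; rewrite ?mulr1 ?mulr0 ?addr0 ?subrr.
have [xFp|xFp] := pselect (residue_in_Fp x); last first.
  rewrite Rp_no_residue // -[_ - _]addr0; apply: (convergesD nv).
    exact: mean_id_converges.
  rewrite (_ : mean 1 e x = fun=> 0); first exact: converges_cst nv _.
  by apply: funext => N; rewrite mean_no_residue.
rewrite Rp_residue //.
rewrite (_ : x - _ = x - 2^-1 + (-1) * (step x - 2^-1)); last by ring.
apply: (convergesD nv); first exact: mean_id_converges.
apply/(converges_shift nv 1).
rewrite (_ : (fun _ => _) = fun N => -1 * mean 1 id (step x) N).
  by apply: (convergesMl nv); exact: mean_id_converges.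
apply: funext => N; rewrite addn1 mean_residue // -meanZ; apply: eq_mean => i.
rewrite /e leNgt abs_mul_step_lt1 //= mulN1r mulrN mulKf //.
by rewrite natr_neq0 ?prime_gt0.
Qed.

(** * Recursion for the stopping index *)

(** An element close to an integer is itself integral, so the two stopping cases merge into one. *)
Lemma stops_at0 x : stops_at x 0 = ~~ `[< residue_in_Fp x >].
Proof.
apply/asboolP/negP => [[xint|[_ xFp]] /asboolP xFp'|xFp].
- apply: xint; rewrite /integral; case: xFp' => a xa.
  by rewrite -(subrK a%:~R x) (absvalD_le nv) ?(ltW xa) ?(absval_int_le1 nv).
- exact: xFp.
by have [xint|xint] := pselect (integral x); [right; split => // /asboolP|left].
Qed.

Lemma xseqS x j : xseq x j.+1 = xseq (step x) j.
Proof. by rewrite /xseq iterSr. Qed.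

Lemma omega0 x : omega x 0 = 0%N.
Proof. by rewrite /omega; case: (stop_index x) => [s|]; rewrite ?min0n. Qed.

Lemma omega_no_residue x r : ~ residue_in_Fp x -> omega x r = 0%N.
Proof.
move=> xFp; have s0 : stops_at x 0 by rewrite stops_at0; apply/asboolP.
rewrite /omega /stop_index; case: pselect => [H|[]]; last by exists 0%N.
by case: ex_minnP => s _ /(_ _ s0); rewrite leqn0 => /eqP ->; rewrite minn0.
Qed.

(** Dropping x_0 lowers both r and the stopping index by one, an infinite index staying infinite. *)
Lemma omega_residue x r :
  residue_in_Fp x -> omega x r.+1 = (omega (step x) r).+1.
Proof.
move=> xFp; have s0 : ~~ stops_at x 0 by rewrite stops_at0 negbK; apply/asboolP.
have sS j : stops_at x j.+1 = stops_at (step x) j by rewrite /stops_at !xseqS.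
rewrite /omega /stop_index; case: pselect => [H|H]; case: pselect => [H'|H'] //.
- case: ex_minnP => -[|s] xs smin; first by rewrite xs in s0.
  case: ex_minnP => t xt tmin; rewrite minnSS; congr (minn _ _).+1.
  apply/eqP; rewrite eqn_leq tmin ?andbT -?sS //.
  by rewrite -ltnS smin ?sS.
- exfalso; case: H => -[|s xs]; first by rewrite (negPf s0).
  by case: H'; exists s; rewrite -sS.
by exfalso; case: H' => s xs; case: H; exists s.+1; rewrite sS.
Qed.

Lemma volkenborn_mean h x l :
  converges abs (mean 1 h x) l -> volkenborn (fun t => h (x + t)) = l.
Proof.
move=> hl; rewrite /volkenborn /plim.
rewrite (_ : (fun N => _) = mean 1 h x).
  by apply: xget_unique => //= l' /(converges_unique nv _ _ _ hl).
by apply: funext => N; rewrite /mean mul1n.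
Qed.

(** * The truncated integrals and the multiplication formula *)

Section Multiplication.
Context {logp : C -> C} (logpI : iwasawa_log logp).

(** Ensures that the value picked by [plim] is a genuine limit and not its default 0. *)
Lemma LogGamma_converges x :
  converges abs (mean 1 (fun y => y * (logp y - 1) * chi y) x)
    (LogGamma logp x).
Proof.
have := log_integrand_differentiable logpI 0.
rewrite (_ : (fun y => y * (logp y - 1 - 0) * chi y) =
             fun y => y * (logp y - 1) * chi y).
  move=> /(mean_converges _ _ x)[l xl].
  rewrite /LogGamma.
  by rewrite (volkenborn_mean (fun y => y * (logp y - 1) * chi y) x l).
by apply: funext => y; rewrite subr0.
Qed.

(* The truncation [p ^- r <= |y|] is what the factor [chi (y / n)] becomes when *)
(* [n] has [p]-adic valuation [r].                                              *)
Definition truncated_integrand (c : C) (r : nat) (y : C) : C :=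
  if q ^+ r <= abs y then y * (logp y - 1 - c) else 0.

Lemma truncated_integrand0_converges c x a :
  converges abs (mean a (truncated_integrand c 0) x)
    (a%:R * (LogGamma logp x - c * Rp x)).
Proof.
have -> : truncated_integrand c 0 = fun y => y * (logp y - 1 - c) * chi y.
  apply: funext => y; rewrite /truncated_integrand expr0 chiE.
  by case: ifP; rewrite ?mulr1 ?mulr0.
apply: mean_mul_converges (log_integrand_differentiable logpI c) _.
rewrite (_ : mean 1 _ x = fun N =>
    mean 1 (fun y => y * (logp y - 1) * chi y) x N
    + (- c) * mean 1 (fun y => y * chi y) x N).
  rewrite -mulNr; apply: (convergesD nv); first exact: LogGamma_converges.
  by apply: (convergesMl nv); exact: mul_chi_converges.
by apply: funext => N; rewrite -meanZ -meanD; apply: eq_mean => i; ring.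
Qed.

Lemma truncated_integrand_mul_prime c r z : abs (p%:R * z) < 1 ->
  p%:R^-1 * (truncated_integrand c r.+1 (p%:R * z)
             - truncated_integrand c 0 (p%:R * z)) = truncated_integrand c r z.
Proof.
move=> pz1; rewrite /truncated_integrand expr0 [1 <= _]leNgt pz1 subr0.
rewrite (absvalM nv) abs_prime exprS ler_pM2l ?q_gt0 //.
case: ifP => [rz|]; last by rewrite mulr0.
have p0 := natr_neq0 p (prime_gt0 p_prime).
have z0 : z != 0.
  apply: contraTneq rz => ->; rewrite (absval_0 nv) -ltNge.
  by rewrite exprn_gt0 ?q_gt0.
by rewrite (iwasawa_logM logpI) // (iwasawa_log_p logpI) add0r -mulrA mulKf.
Qed.

Lemma truncated_integrand_converges c r x a :
  converges abs (mean a (truncated_integrand c r) x)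
    (a%:R * \sum_(j < (omega x r).+1)
       (LogGamma logp (xseq x j) - c * Rp (xseq x j))).
Proof.
elim: r x => [|r IHr] x.
  by rewrite omega0 big_ord1; exact: truncated_integrand0_converges.
(* The part of the integrand on p^-(r+1) <= |y| < 1: it contributes nothing if x has no residue in
   F_p, and otherwise becomes the truncation of depth r at [step x]. *)
pose e y := truncated_integrand c r.+1 y - truncated_integrand c 0 y.
have e0 y : 1 <= abs y -> e y = 0.
  move=> y1; rewrite /e /truncated_integrand expr0 y1 (le_trans _ y1) ?subrr //.
  by case/andP: q_itv => q0 /ltW q1; exact: exprn_ile1.
have -> : mean a (truncated_integrand c r.+1) x =
    fun N => mean a (truncated_integrand c 0) x N + mean a e x N.
  by apply: funext => N; rewrite -meanD; apply: eq_mean => i; rewrite /e subrKC.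
have [xFp|xFp] := pselect (residue_in_Fp x); last first.
  rewrite omega_no_residue // big_ord1 -[_ * _]addr0; apply: (convergesD nv).
    exact: truncated_integrand0_converges.
  rewrite (_ : mean a e x = fun=> 0); first exact: converges_cst nv _.
  by apply: funext => N; rewrite mean_no_residue.
rewrite omega_residue // big_ord_recl mulrDr; apply: (convergesD nv).
  exact: truncated_integrand0_converges.
apply/(converges_shift nv 1).
rewrite (_ : (fun _ => _) = mean a (truncated_integrand c r) (step x)); last first.
  apply: funext => N; rewrite addn1 mean_residue //; apply: eq_mean => i.
  by rewrite truncated_integrand_mul_prime ?abs_mul_step_lt1.
under eq_bigr do rewrite lift0 xseqS.
exact: IHr.
Qed.

Lemma sum_mean_div x (n m r N : nat) :
  n = (m * p ^ r)%N -> (0 < m)%N -> ~~ (p %| m)%N ->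
  \sum_(k < n)
    mean 1 (fun y => y * (logp y - 1) * chi y) ((x + k%:R) / n%:R) N =
  m%:R^-1 * mean m (truncated_integrand (logp n%:R) r) x (N + r).
Proof.
move=> nE m0 pm; have pr0 s : (0 < p ^ s)%N by rewrite expn_gt0 prime_gt0.
have n0 : (0 < n)%N by rewrite nE muln_gt0 m0 pr0.
have nC := natr_neq0 n n0; have mC := natr_neq0 m m0.
have n_abs : abs n%:R = q ^+ r.
  rewrite abs_nat // nE lognM // pfactorK // [logn p m]lognE.
  by rewrite (negPf pm) !andbF.
have scaleE y : y / n%:R * (logp (y / n%:R) - 1) * chi (y / n%:R) =
    n%:R^-1 * truncated_integrand (logp n%:R) r y.
  rewrite /truncated_integrand chiE (absvalM nv) (absvalV nv) n_abs.
  rewrite ler_pdivlMr ?exprn_gt0 ?q_gt0 // mul1r.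
  case: ifP => [ry|]; last by rewrite !mulr0.
  have y0 : y != 0.
    apply: contraTneq ry => ->; rewrite (absval_0 nv) -ltNge.
    by rewrite exprn_gt0 ?q_gt0.
  have -> : logp (y / n%:R) = logp y - logp n%:R.
    apply: (addIr (logp n%:R)); rewrite subrK -(iwasawa_logM logpI) ?divfK //.
    by rewrite mulf_neq0 ?invr_neq0.
  by rewrite mulr1; ring.
rewrite /mean -mulr_sumr mul1n exchange_big /=.
(* Writing l = i n + k with k < n matches x + l with n ((x + k)/n + i). *)
rewrite [in RHS](_ : (m * p ^ (N + r) = p ^ N * n)%N); last first.
  by rewrite nE expnD mulnCA.
rewrite (sum_ord_mul _ (fun i => truncated_integrand (logp n%:R) r (x + i%:R))).
have -> : (p ^ (N + r))%:R = (p ^ N)%:R * n%:R / m%:R :> C.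
  by rewrite nE expnD !natrM mulrCA [RHS]mulrC mulKf.
rewrite !invfM invrK -mulrA mulrCA mulKf // -mulrA; congr (_ * _).
rewrite mulr_sumr; apply: eq_bigr => i _.
rewrite mulr_sumr; apply: eq_bigr => k _.
rewrite (_ : _ / _ + _ = (x + (i * n + k)%:R) / n%:R) ?scaleE //.
by rewrite natrD natrM; field.
Qed.

End Multiplication.

End PadicComplex.

Theorem theorem4p8 (R : realType) (p : nat) (p_prime : prime p)
    (C : padicComplex R p) (logp : C -> C) (logp_iwasawa : iwasawa_log logp)
    (x : C) (n m r : nat) (n_def : n = (m * p ^ r)%N)
    (m_pos : (0 < m)%N) (p_ndvd_m : ~~ (p %| m)%N) :
  \sum_(0 <= k < n) LogGamma logp ((x + k%:R) / n%:R) =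
  \sum_(0 <= j < (omega x r).+1) LogGamma logp (xseq x j)
    - logp n%:R * \sum_(0 <= j < (omega x r).+1) Rp (xseq x j).
Proof.
rewrite !big_mkord mulr_sumr -sumrB.
have nv := Cp_absval C; have m0 := natr_neq0 p_prime m m_pos.
have LHS := converges_sum nv _ _ _
  (fun k : 'I_n => LogGamma_converges p_prime logp_iwasawa ((x + k%:R) / n%:R)).
have RHS := convergesMl nv m%:R^-1 _ _
  (truncated_integrand_converges p_prime logp_iwasawa (logp n%:R) r x m).
(* Both sides are limits of one sequence, up to the index shift by r from [sum_mean_div]. *)
rewrite mulKf // in RHS; apply: (converges_unique nv _ _ _ LHS).
move: RHS; rewrite -(converges_shift nv r); congr (converges _ _ _).
by apply: funext => N; rewrite (sum_mean_div p_prime logp_iwasawa x n m r).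
Qed.
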